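(* There exists a universal constant $c>0$ such that for all $T\in\mathbb{N}$, all $\ell\ge1$, $\rho\ge1$, all $\delta\in(0,\tfrac13)$, and every stochastic optimization algorithm $\mathsf{alg}\in\mathcal{A}_{\mathsf{SO}}$, $$\mathsf{PoA}_T^{\delta}\big(\mathsf{alg},\mathcal{M}_{\mathsf{Lip}}^{\ell,\rho}\big)\;\ge\; c\,\min\left\{\frac{\min\{\ell,\rho\}\sqrt{\log\frac1\delta}}{\sqrt{T}},\ \sqrt{\frac{T}{\log\frac1\delta}}\right\}$$ and $$\mathsf{PoA}_T^{\delta}\big(\mathsf{alg},\mathcal{M}_{\mathsf{SM\text{-}Lip}}^{\ell,\rho}\big)\;\ge\; c\,\min\left\{\rho,\ \ell,\ \sqrt{\frac{T}{\log\frac1\delta}}\right\}.$$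
   Context: Here $\mathbb{N}=\{1,2,\dots\}$, $\log$ is the natural logarithm, and the domain is $\mathcal{X}=\mathbb{R}$. Stochastic optimization (SO) instances. An SO instance is a pair $(f,P)$, where $P$ is a probability distribution on a sample space $\mathcal{S}$ and $f:\mathcal{X}\times\mathcal{S}\to\mathbb{R}$ is such that $F_{f,P}(x):=\mathbb{E}_{S\sim P}f(x;S)$ is well defined and finite for all $x\in\mathcal{X}$. Let $X^\star_{f,P}:=\arg\min_{x\in\mathcal{X}}F_{f,P}(x)$. The norm of a set means the infimum of the norms of its elements ($\infty$ for the empty set). Each convex sample function $f(\cdot;s)$ comes with an arbitrary (measurable) subgradient selection $\nabla f(x;s)\in\partial f(x;s)$, regarded as part of the instance. For $L,R>0$: $\mathcal{I}_{\mathsf{Lip}}^{L,R}$ is the class of instances such that $f(\cdot;s)$ is convex and $L$-Lipschitz on $\mathcal{X}$ for all $s\in\mathcal{S}$, and $\|X^\star_{f,P}\|\le R$; $\mathcal{I}_{\mathsf{SM\text{-}Lip}}^{L,R}$ is the class of instances such that $f(\cdot;s)$ is convex for all $s\in\mathcal{S}$, $\mathbb{E}_{S\sim P}\|\nabla f(x;S)\|^2\le L^2$ for all $x\in\mathcal{X}$, and $\|X^\star_{f,P}\|\le R$. Algorithms. $\mathcal{A}_{\mathsf{SO}}$ is the set of all SO algorithms: given $S_1,\dots,S_T$ i.i.d. from $P$ and independent $\xi\sim\mathsf{Unif}([0,1])$, the output is $x_T=\mathsf{alg}_T(f(\cdot;S_1),\dots,f(\cdot;S_T);\xi)\in\mathcal{X}$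 for some measurable mapping $\mathsf{alg}_T$ (the sample functions are given together with their subgradient selections). Error at confidence level $\delta$. $\mathsf{Err}_T^{\delta}(\mathsf{alg},(f,P)):=Q_{1-\delta}(F_{f,P}(x_T))-\inf_{x\in\mathcal{X}}F_{f,P}(x)$, where $Q_p(Y):=\min\{y:\mathbb{P}(Y\le y)\ge p\}$. For a class $\mathcal{I}$ of instances, $\mathsf{Err}_T^{\delta}(\mathsf{alg},\mathcal{I}):=\sup_{(f,P)\in\mathcal{I}}\mathsf{Err}_T^{\delta}(\mathsf{alg},(f,P))$, and $\mathsf{Err}_T^{\delta}(\mathcal{A}_{\mathsf{SO}},\mathcal{I}):=\inf_{\mathsf{alg}\in\mathcal{A}_{\mathsf{SO}}}\mathsf{Err}_T^{\delta}(\mathsf{alg},\mathcal{I})$. Price of adaptivity. For $\ell,\rho\ge1$, $\mathcal{M}_{\mathsf{Lip}}^{\ell,\rho}:=\{\mathcal{I}_{\mathsf{Lip}}^{L,R}: L\in[1,\ell],\,R\in[1,\rho]\}$ and $\mathcal{M}_{\mathsf{SM\text{-}Lip}}^{\ell,\rho}:=\{\mathcal{I}_{\mathsf{SM\text{-}Lip}}^{L,R}: L\in[1,\ell],\,R\in[1,\rho]\}$. For a collection $\mathcal{M}$ of instance classes, $\mathsf{PoA}_T^{\delta}(\mathsf{alg},\mathcal{M}):=\sup_{\mathcal{I}\in\mathcal{M}}\dfrac{\mathsf{Err}_T^{\delta}(\mathsf{alg},\mathcal{I})}{\mathsf{Err}_T^{\delta}(\mathcal{A}_{\mathsf{SO}},\mathcal{I})}$.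 *)

(* Defs.v *)
From HB Require Import structures.
From mathcomp Require Import all_boot all_order all_algebra.
From mathcomp Require Import all_classical all_reals all_analysis.

Set Implicit Arguments.
Unset Strict Implicit.
Unset Printing Implicit Defensive.

Import Order.TTheory GRing.Theory Num.Theory.
Import numFieldNormedType.Exports.

Local Open Scope classical_set_scope.
Local Open Scope ring_scope.

Section iid_product.
Context {d : measure_display} {S : measurableType d} {R : realType}.
Variable P : probability S R.

Definition consT (n : nat) (w : S * n.-tuple S) : n.+1.-tuple S :=
  [tuple of w.1 :: w.2].

Lemma measurable_consT (n : nat) :
  measurable_fun [set: S * n.-tuple S] (@consT n).
Proof. exact: (measurable_cons measurable_fst measurable_snd). Qed.

HB.instance Definition _ (n : nat) :=
  isMeasurableFun.Build _ _ _ _ (@consT n) (@measurable_consT n).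

(* The n-fold product law P x ... x P of n i.i.d. samples from P. *)
Fixpoint iid (n : nat) : probability (n.-tuple S) R :=
  match n with
  | 0 => \d_[tuple]
  | m.+1 => distribution (P \x iid m)%E (@consT m)
  end.

End iid_product.

Section stochastic_optimization.
Variable R : realType.

Definition subdifferential (h : R -> R) (x : R) : set R :=
  [set v | forall y, h x + v * (y - x) <= h y].

Definition convex_on_line (h : R -> R) : Prop :=
  convex_function ([set: R^o]) (h : R^o -> R^o).

(* Measurability of the selection is joint in (x, s), so that iterates such as
   x - eta * grad x s are random variables when x is. *)
Record instance := Instance {
  disp : measure_display;
  sample : measurableType disp;
  law : probability sample R;
  loss : R -> sample -> R;
  grad : R -> sample -> R;
  loss_integrable :
    forall x, law.-integrable [set: sample] (fun s => (loss x s)%:E);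
  grad_measurable :
    measurable_fun [set: R * sample] (fun z => grad z.1 z.2);
  grad_subdifferential :
    forall s, convex_on_line (loss ^~ s) ->
    forall x, subdifferential (loss ^~ s) x (grad x s)
}.

Arguments loss : clear implicits.
Arguments grad : clear implicits.

(* [set instance] and its image notations are unavailable: the universe of
   [instance] exceeds the bound on the carrier of [set]. *)
Definition instance_class := instance -> Prop.

Definition convex_instance (I : instance) : Prop :=
  forall s : sample I, convex_on_line (loss I ^~ s).

Definition objective (I : instance) (x : R) : R :=
  fine 'E_(law I)[loss I x].

Definition minimizers (I : instance) : set R :=
  [set x | forall y, objective I x <= objective I y].

(* [ereal_inf set0 = +oo]. *)
Definition set_norm (A : set R) : \bar R := ereal_inf [set `|x|%:E | x in A].

Definition class_Lip (L r : R) : instance_class :=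
  fun I => [/\ convex_instance I,
    forall s : sample I, L.-lipschitz (loss I ^~ s : R -> R) &
    (set_norm (minimizers I) <= r%:E)%E].

Definition class_SMLip (L r : R) : instance_class :=
  fun I => [/\ convex_instance I,
    forall x, ('E_(law I)[fun s => `|grad I x s| ^+ 2]%R
                <= (L ^+ 2)%:E)%E &
    (set_norm (minimizers I) <= r%:E)%E].

(* What an algorithm is given about a sample s: f(.;s) and its selection. *)
Definition sample_data (I : instance) (s : sample I) : (R -> R) * (R -> R) :=
  (loss I ^~ s, grad I ^~ s).

Definition run (T : nat) (alg : T.-tuple ((R -> R) * (R -> R)) -> R -> R)
    (I : instance) (w : T.-tuple (sample I) * measurableTypeR R) : R :=
  alg (map_tuple (@sample_data I) w.1) w.2.

(* Measurability of alg_T is taken with respect to the final sigma-algebra: a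
   set of (T-tuples of sample functions, seed) is measurable when its preimage
   in sample^T x seeds is, for every convex instance; equivalently, the output
   is a measurable function of the samples and the seed. (With the cylinder
   sigma-algebra on functions, evaluating a subgradient selection at a
   data-dependent point would not be measurable.) Seeds are drawn from [0, 1];
   their type is the whole line, and what alg_T does off [0, 1] is immaterial. *)
Record algorithm (T : nat) := Algorithm {
  alg_fun :> T.-tuple ((R -> R) * (R -> R)) -> R -> R;
  alg_measurable : forall I, convex_instance I ->
    measurable_fun [set: T.-tuple (sample I) * measurableTypeR R]
      (run alg_fun (I := I))
}.

Definition run_law (T : nat) (I : instance) :
    probability (T.-tuple (sample I) * measurableTypeR R)%type R :=
  (iid (law I) T \x uniform_prob (@ltr01 R))%E.

(* For 0 < p < 1 the infimum is attained, by right-continuity of the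
   distribution function of Y. *)
Definition quantile (d : measure_display) (W : measurableType d)
    (Q : probability W R) (p : R) (Y : W -> R) : \bar R :=
  ereal_inf [set y%:E | y in [set y | (p%:E <= Q [set w | (Y w <= y)%R])%E]].

Definition Err (T : nat) (delta : R) (alg : algorithm T) (I : instance)
    : \bar R :=
  (quantile (run_law T I) (1 - delta)
     (fun w => objective I (run alg w))
   - ereal_inf [set (objective I x)%:E | x in [set: R]])%E.

Definition Err_class (T : nat) (delta : R) (alg : algorithm T)
    (C : instance_class) : \bar R :=
  ereal_sup [set e | exists2 I, C I & e = Err delta alg I].

Definition Err_minimax (T : nat) (delta : R) (C : instance_class) : \bar R :=
  ereal_inf [set e | exists alg : algorithm T, e = Err_class delta alg C].

Definition PoA (T : nat) (delta : R) (alg : algorithm T)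
    (M : instance_class -> Prop) : \bar R :=
  ereal_sup [set q | exists2 C, M C &
    q = (Err_class delta alg C / Err_minimax T delta C)%E].

Definition family_Lip (l rho : R) (C : instance_class) : Prop :=
  exists L r : R, [/\ 1 <= L <= l, 1 <= r <= rho & C = class_Lip L r].

Definition family_SMLip (l rho : R) (C : instance_class) : Prop :=
  exists L r : R, [/\ 1 <= L <= l, 1 <= r <= rho & C = class_SMLip L r].

End stochastic_optimization.

(* Main.v *)
(* Write s = sqrt (log (1/delta) / T).

   Upper bound: in one dimension the sample gradients are nondecreasing in x, so
   the sign of the mean gradient only has to be tested reliably at two points,
   the last grid point where it is very negative and the first one where it is
   very positive.  A product of tilted gradients, monotone in x and controlled
   by second moments alone, gives such a test, so that the minimax error of the
   second-moment class, hence of the Lipschitz class, is at most 24 L R s.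

   Lower bound: let all samples be eps |x - rho|, with eps of order K s.  An
   algorithm that is K-competitive for (L, R) = (1, rho) must output x >= rho/2.
   Now replace a sample by (2 eps / p) |x| with a probability p of order
   min (1, s^2).  With probability at least sqrt delta no replacement is seen, so
   the output is still >= rho/2, although the minimizer is now 0; the resulting
   error eps rho / 2 is at least K times the rate for (min (l, rho), 1). *)
Require Import Defs.
From mathcomp Require Import all_boot all_order all_algebra.
From mathcomp Require Import all_classical all_reals all_analysis.
From mathcomp Require Import measurable_realfun.
From mathcomp Require Import ring lra.

Set Implicit Arguments.
Unset Strict Implicit.
Unset Printing Implicit Defensive.

Import Order.TTheory GRing.Theory Num.Theory.
Import numFieldNormedType.Exports.

Local Open Scope classical_set_scope.
Local Open Scope ring_scope.

Section level_sets.
Context {d : measure_display} {S : measurableType d} {R : realType}.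
Variable f : S -> R.
Hypothesis mf : measurable_fun [set: S] f.

Lemma measurable_ge_set v : measurable [set s | v <= f s].
Proof.
rewrite -[X in measurable X]setTI (_ : [set s | _] = f @^-1` `[v, +oo[).
  exact: mf.
by apply/seteqP; split => s /=; rewrite in_itv/= andbT.
Qed.

Lemma measurable_le_set v : measurable [set s | f s <= v].
Proof.
rewrite -[X in measurable X]setTI (_ : [set s | _] = f @^-1` `]-oo, v]).
  exact: mf.
by apply/seteqP; split => s /=; rewrite in_itv.
Qed.

Lemma measurable_lt_set v : measurable [set s | f s < v].
Proof.
rewrite -[X in measurable X]setTI (_ : [set s | _] = f @^-1` `]-oo, v[).
  exact: mf.
by apply/seteqP; split => s /=; rewrite in_itv.
Qed.

End level_sets.

Section iid_product_law.
Context {d : measure_display} {S : measurableType d} {R : realType}.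
Variable P : probability S R.

Lemma measurable_tuple_box n (A : set S) : measurable A ->
  measurable [set w : n.-tuple S | forall i, A (tnth w i)].
Proof.
move=> mA.
rewrite (_ : [set w | _] =
    \bigcap_(i in [set: 'I_n]) ((@tnth n S)^~ i @^-1` A)); last first.
  by apply/seteqP; split => w /=; [move=> h i _; exact: h | move=> h i; exact: h].
apply: fin_bigcap_measurable => // i _.
by rewrite -[X in measurable X]setTI; exact: measurable_tnth.
Qed.

Lemma tnth_consT n (a : S) (w : n.-tuple S) (i : 'I_n) :
  tnth (consT (a, w)) (lift ord0 i) = tnth w i.
Proof. by rewrite !(tnth_nth a). Qed.

Lemma iid_box n (A : set S) : measurable A ->
  iid P n [set w | forall i, A (tnth w i)] = (P A ^+ n)%E.
Proof.
move=> mA; elim: n => [|n IH]; rewrite ?expeS /=.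
  by rewrite diracE mem_set// => -[].
rewrite /distribution /pushforward /=.
rewrite (_ : _ @^-1` _ = A `*` [set w : n.-tuple S | forall i, A (tnth w i)]).
  rewrite product_measure1E//; last exact: measurable_tuple_box.
  by congr (_ * _)%E; exact: IH.
apply/seteqP; split => -[a w] /=.
- move=> h; split; first exact: (h ord0).
  by move=> i; rewrite -(tnth_consT a); exact: h.
- move=> [h0 h1] i; case: (unliftP ord0 i) => [j ->|->]; last exact: h0.
  by rewrite tnth_consT.
Qed.

Lemma measurable_tuple_prod n (h : S -> R) : measurable_fun [set: S] h ->
  measurable_fun [set: n.-tuple S] (fun w => \prod_(i < n) h (tnth w i)).
Proof.
move=> mh; apply: measurable_prod => i _.
by apply: (measurableT_comp mh); exact: measurable_tnth.
Qed.

Lemma integral_iid_prod n (h : S -> R) : measurable_fun [set: S] h ->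
  (forall s, 0 <= h s) ->
  (\int[iid P n]_w (\prod_(i < n) h (tnth w i))%:E
    = (\int[P]_s (h s)%:E) ^+ n)%E.
Proof.
move=> mh h0; elim: n => [|n IH].
  rewrite (eq_integral (cst 1%E)); last by move=> w _; rewrite big_ord0.
  by rewrite integral_cst// mul1e; exact: probability_setT.
rewrite [iid _ _]/= ge0_integral_pushforward//; last 2 first.
- by apply/measurable_EFinP; exact: measurable_tuple_prod.
- by move=> w _; rewrite lee_fin prodr_ge0.
rewrite preimage_setT fubini_tonelli1; last 2 first.
- apply/measurable_EFinP.
  exact: (measurableT_comp (measurable_tuple_prod mh) (@measurable_consT _ S n)).
- by move=> w; rewrite lee_fin prodr_ge0.
rewrite expeS -IH -ge0_integralZr//; last 3 first.
- by apply/measurable_EFinP.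
- by move=> s _; rewrite lee_fin.
- by apply: integral_ge0 => w _; rewrite lee_fin prodr_ge0.
apply: eq_integral => s _; rewrite /fubini_F -ge0_integralZl_EFin//; last 2 first.
- by move=> w _; rewrite lee_fin prodr_ge0.
- by apply/measurable_EFinP; exact: measurable_tuple_prod.
apply: eq_integral => w _ /=; rewrite big_ord_recl /= -EFinM; congr (_ * _)%:E.
by apply: eq_bigr => i _; rewrite tnth_consT.
Qed.

Lemma iid_prod_ge1 n (h : S -> R) (q : R) : measurable_fun [set: S] h ->
  (forall s, 0 <= h s) -> (\int[P]_s (h s)%:E <= q%:E)%E ->
  (iid P n [set w | (1 <= \prod_(i < n) h (tnth w i))%R] <= (q ^+ n)%:E)%E.
Proof.
move=> mh h0 hq; set A := [set w | _].
have mW := @measurable_tuple_prod n h mh.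
have mA : measurable A := measurable_ge_set mW 1.
have I0 : (0 <= \int[P]_s (h s)%:E)%E by apply: integral_ge0 => s _; rewrite lee_fin.
rewrite EFin_expe; apply: (@le_trans _ _ ((\int[P]_s (h s)%:E) ^+ n)%E); last first.
  elim: n {A mW mA} => [//|n IH]; rewrite !expeS; apply: lee_pmul => //.
  by apply: expe_ge0.
rewrite -integral_iid_prod// -[A]setIT -integral_indic//.
apply: ge0_le_integral => //.
- by apply/measurable_EFinP; exact: measurable_indic.
- by apply/measurable_EFinP.
- move=> w _; rewrite lee_fin indicE; case: (boolP (w \in A)) => [|_].
    by rewrite inE.
  exact: prodr_ge0.
Qed.

End iid_product_law.

Section tilt.
Context {R : realType}.
Implicit Types u v : R.

(* Nondecreasing, at most 1 + u + u^2, and inverted by u |-> - u: its products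
   have both tails controlled by two moments, as for Catoni's estimator. *)
Definition tilt (u : R) : R :=
  if 0 <= u then 1 + u + u ^+ 2 else (1 - u + u ^+ 2)^-1.

Lemma tilt_den_gt0 u : 0 < 1 - u + u ^+ 2.
Proof. by have := sqr_ge0 (u - 2^-1); nra. Qed.

Lemma tilt_num_gt0 u : 0 < 1 + u + u ^+ 2.
Proof. by have := sqr_ge0 (u + 2^-1); nra. Qed.

Lemma tilt_gt0 u : 0 < tilt u.
Proof.
by rewrite /tilt; case: ifP => _; rewrite ?invr_gt0 ?tilt_den_gt0 ?tilt_num_gt0.
Qed.

Lemma tiltN u : tilt (- u) = (tilt u)^-1.
Proof.
rewrite /tilt oppr_ge0 sqrrN opprK; case: ltgtP => [u0|u0|->].
- by rewrite invrK.
- by [].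
- by rewrite oppr0 addr0 expr0n/= addr0 invr1.
Qed.

Lemma tilt_le u : tilt u <= 1 + u + u ^+ 2.
Proof.
rewrite /tilt; case: ifP => // _.
rewrite -[_^-1]mul1r ler_pdivrMr ?tilt_den_gt0//.
have := sqr_ge0 u; have := sqr_ge0 (u ^+ 2); nra.
Qed.

Lemma tilt_nondecreasing : {homo tilt : u v / u <= v}.
Proof.
move=> u v uv; rewrite /tilt; case: (leP 0 u) => u0; case: (leP 0 v) => v0.
- nra.
- lra.
- apply: (@le_trans _ _ 1); last by nra.
  by rewrite invf_le1 ?tilt_den_gt0//; nra.
- by rewrite lef_pV2 ?posrE ?tilt_den_gt0//; nra.
Qed.

Lemma measurable_tilt : measurable_fun [set: R] tilt.
Proof. by apply: nondecreasing_measurable => //; exact: tilt_nondecreasing. Qed.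

End tilt.

Section second_moment.
Context {d : measure_display} {S : measurableType d} {R : realType}.
Variable P : probability S R.

Lemma integrable_cst (a : R) : P.-integrable [set: S] (EFin \o cst a).
Proof. by apply: finite_measure_integrable_cst. Qed.

Variables (g : S -> R) (L : R).
Hypothesis mg : measurable_fun [set: S] g.
Hypothesis g2 : (\int[P]_s (g s ^+ 2)%:E <= (L ^+ 2)%:E)%E.

Lemma integrable_sqr : P.-integrable [set: S] (EFin \o (fun s => g s ^+ 2)).
Proof.
apply/integrableP; split; first by apply/measurable_EFinP; exact: measurable_funX.
under eq_integral do rewrite /= ger0_norm ?sqr_ge0//.
exact: le_lt_trans g2 (ltry _).
Qed.

Lemma integrable_of_sqr : P.-integrable [set: S] (EFin \o g).
Proof.
apply: (@le_integrable _ _ _ _ _ _ _ (EFin \o (fun s => 1 + g s ^+ 2))) => //.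
- exact/measurable_EFinP.
- move=> s _ /=; rewrite lee_fin [X in _ <= X]ger0_norm ?addr_ge0 ?sqr_ge0//.
  by rewrite ler_norml; have := sqr_ge0 (g s - 1); have := sqr_ge0 (g s + 1);
    move=> ? ?; apply/andP; split; nra.
- apply: (integrableD (measurableT) (integrable_cst 1) integrable_sqr).
Qed.

Lemma Rintegral_sqr_le : \int[P]_s (g s ^+ 2) <= L ^+ 2.
Proof.
rewrite -lee_fin fineK//; exact: integrable_fin_num integrable_sqr.
Qed.

Lemma Rintegral_quadratic (a b c : R) :
  \int[P]_s (a + b * g s + c * g s ^+ 2)
    = a + b * (\int[P]_s g s) + c * (\int[P]_s (g s ^+ 2)).
Proof.
have i1 := integrable_cst a.
have i2 := integrableZl measurableT b integrable_of_sqr.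
have i3 := integrableZl measurableT c integrable_sqr.
rewrite RintegralD//; last exact: (integrableD measurableT i1 i2).
rewrite RintegralD// !RintegralZl//; [|exact: integrable_sqr|exact: integrable_of_sqr].
have PT : fine (P setT) = 1 by rewrite probability_setT.
by rewrite Rintegral_cst//; congr (_ + _ + _); rewrite -[RHS]mulr1 -PT.
Qed.

Lemma integrable_quadratic (a b c : R) :
  P.-integrable [set: S] (EFin \o (fun s => a + b * g s + c * g s ^+ 2)).
Proof.
have i2 := integrableZl measurableT b integrable_of_sqr.
have i3 := integrableZl measurableT c integrable_sqr.
exact: (integrableD measurableT (integrableD measurableT (integrable_cst a) i2) i3).
Qed.

Lemma Rintegral_le_of_sqr : 0 < L -> \int[P]_s g s <= L.
Proof.
move=> L0.
have : 0 <= \int[P]_s (L ^+ 2 + (- (2 * L)) * g s + 1 * g s ^+ 2).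
  by apply: Rintegral_ge0 => s _; have := sqr_ge0 (L - g s); nra.
by rewrite Rintegral_quadratic; have := Rintegral_sqr_le; nra.
Qed.

Lemma integral_tilt_le (a : R) :
  (\int[P]_s (tilt (a * g s))%:E
    <= (1 + a * (\int[P]_s g s) + a ^+ 2 * L ^+ 2)%:E)%E.
Proof.
apply: (@le_trans _ _ (\int[P]_s (1 + a * g s + a ^+ 2 * g s ^+ 2)%:E)%E).
  apply: ge0_le_integral => //.
  - by move=> s _; rewrite lee_fin ltW// tilt_gt0.
  - apply/measurable_EFinP; apply: (measurableT_comp measurable_tilt).
    exact: measurable_funM.
  - exact/measurable_int/integrable_quadratic.
  - by move=> s _; rewrite lee_fin -exprMn tilt_le.
have qi := integrable_quadratic 1 a (a ^+ 2).
rewrite -[X in (X <= _)%E]fineK; last exact: integrable_fin_num qi.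
rewrite lee_fin -/(Rintegral _ _ _) Rintegral_quadratic lerD2l.
by apply: ler_wpM2l; rewrite ?sqr_ge0// Rintegral_sqr_le.
Qed.

End second_moment.

Section objective_of_instance.
Context {R : realType}.
Variables (I : instance R) (L : R).
Hypothesis cvxI : convex_instance I.
Hypothesis gradI :
  forall x, (\int[law I]_s (grad x s ^+ 2)%:E <= (L ^+ 2)%:E)%E.

Definition slope (x : R) : R := \int[law I]_s grad x s.

Lemma measurable_grad x : measurable_fun [set: sample I] (grad (i:=I) x).
Proof.
exact: (measurableT_comp (@grad_measurable R I)
  (@pair1_measurable _ _ _ (sample I) x)).
Qed.

Lemma grad_nondecreasing (s : sample I) x y : x <= y -> grad x s <= grad y s.
Proof.
rewrite le_eqVlt => /predU1P[->//|xy].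
have := grad_subdifferential (cvxI s) x y.
have := grad_subdifferential (cvxI s) y x; move=> /= h1 h2.
have {h1 h2}: 0 <= (grad y s - grad x s) * (y - x) by nra.
by rewrite pmulr_lge0 ?subr_gt0// subr_ge0.
Qed.

Lemma objectiveE x : objective I x = \int[law I]_s loss x s.
Proof. by rewrite /objective unlock. Qed.

Lemma objective_subgradient x y : objective I x + slope x * (y - x) <= objective I y.
Proof.
rewrite !objectiveE /slope.
have ix := @loss_integrable R I x; have iy := @loss_integrable R I y.
have ig : (law I).-integrable setT (EFin \o (fun s => grad x s * (y - x))).
  exact: (integrableZr measurableT (y - x)
    (integrable_of_sqr (measurable_grad x) (gradI x))).
rewrite -RintegralZr//; last exact: (integrable_of_sqr (measurable_grad x) (gradI x)).
rewrite -RintegralD//; apply: le_Rintegral => //.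
  exact: (integrableD measurableT ix ig).
by move=> s _; exact: (grad_subdifferential (cvxI s) x y).
Qed.

Lemma slope_le : 0 < L -> forall x, slope x <= L.
Proof.
by move=> L0 x; exact: (Rintegral_le_of_sqr (measurable_grad x) (gradI x) L0).
Qed.

Lemma measurable_objective_sublevel v :
  measurable [set x : R | objective I x <= v].
Proof.
apply: is_interval_measurable => x y /= hx hy z /andP[xz zy].
have hzx := objective_subgradient z x; have hzy := objective_subgradient z y.
by case: (leP 0 (slope z)) => g0; nra.
Qed.

End objective_of_instance.

Section quantiles.
Context {d : measure_display} {W : measurableType d} {R : realType}.
Variable Q : probability W R.

Lemma quantile_le (p v : R) (Y : W -> R) (A : set W) :
  measurable A -> measurable [set w | Y w <= v] ->
  A `<=` [set w | Y w <= v] -> (p%:E <= Q A)%E -> (quantile Q p Y <= v%:E)%E.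
Proof.
move=> mA mY AY pA; apply: ereal_inf_lbound; exists v => //=.
by apply: (le_trans pA); rewrite le_measure ?inE.
Qed.

Lemma quantile_ge (p v : R) (Y : W -> R) (A : set W) :
  measurable A -> (forall y, measurable [set w | Y w <= y]) ->
  A `<=` [set w | v <= Y w] -> ((1 - p)%:E < Q A)%E -> (v%:E <= quantile Q p Y)%E.
Proof.
move=> mA mY AY pA; apply/ereal_infP => _ [y /= hy <-].
rewrite lee_fin leNgt; apply/negP => yv.
have : (Q A + Q [set w | (Y w <= y)%R] <= 1)%E.
  rewrite -measureU//; first by apply: probability_le1; exact: measurableU.
  rewrite -subset0 => w [/AY /= h1 /= h2].
  by have := le_lt_trans (le_trans h1 h2) yv; rewrite ltxx.
move: pA hy.
rewrite -(fineK (fin_num_measure Q _ mA)) -(fineK (fin_num_measure Q _ (mY y))).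
rewrite -EFinD !lee_fin !lte_fin => {mA mY AY}; set a := fine _; set b := fine _; lra.
Qed.

Lemma quantile_lt (p v : R) (Y : W -> R) : (quantile Q p Y < v%:E)%E ->
  exists2 y, y < v & (p%:E <= Q [set w | (Y w <= y)%R])%E.
Proof.
move=> /ereal_inf_lt[_ [y /= hy <-]]; rewrite lte_fin => yv.
by exists y.
Qed.

End quantiles.

Section grid.
Context {R : realType}.

Definition grid (lo h : R) (j : nat) : R := lo + h * j%:R.

Lemma grid_nondecreasing lo h : 0 <= h ->
  {homo grid lo h : i j / (i <= j)%N >-> i <= j}.
Proof.
by move=> h0 i j ij; rewrite /grid lerD2l ler_wpM2l// ler_nat.
Qed.

Lemma gridS lo h j : grid lo h j.+1 = grid lo h j + h.
Proof. by rewrite /grid -natr1 mulrDr mulr1 addrA. Qed.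

Lemma sum_prefix (N : nat) (b : nat -> bool) :
  (forall i j, (i <= j)%N -> b j -> b i) ->
  let c := (\sum_(j < N) b j)%N in
  [/\ (c <= N)%N, forall k, c = k.+1 -> b k & (c < N)%N -> ~~ b c].
Proof.
move=> bmono /=; elim: N => [|N [IH1 IH2 IH3]].
  by rewrite big_ord0; split.
rewrite big_ord_recr /=; set c := (\sum_(j < N) b j)%N in IH1 IH2 IH3 *.
case bN : (b N); last first.
  rewrite addn0; split; [exact: leqW| exact: IH2 |].
  rewrite ltnS leq_eqVlt => /predU1P[->|/IH3//].
  by rewrite bN.
have cN : c = N.
  apply/eqP; rewrite eqn_leq IH1 /= leqNgt; apply/negP => cN.
  by have := IH3 cN; rewrite (bmono _ _ IH1 bN).
by rewrite cN addn1; split=> // [k [<-]//|]; rewrite ltnn.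
Qed.

Lemma grid_crossing (F G : R -> R) (lo h eta L xs : R) (N : nat) (W : nat -> R) :
  (forall x y, F x + G x * (y - x) <= F y) -> (forall x, G x <= L) ->
  0 <= h -> 0 <= eta -> 0 <= L -> lo <= xs <= grid lo h N ->
  (forall i j, (i <= j)%N -> W i <= W j) ->
  (forall j, (j < N)%N -> G (grid lo h j) <= - eta -> W j < 1) ->
  (forall j, (j < N)%N -> eta <= G (grid lo h j) -> 1 <= W j) ->
  F (grid lo h (\sum_(j < N) (W j < 1)%R)) <= F xs + eta * (h * N%:R) + L * h.
Proof.
move=> FG GL h0 eta0 L0 /andP[loxs xsN] Wmono Wlow Whigh.
have bmono i j : (i <= j)%N -> W j < 1 -> W i < 1.
  by move=> ij; apply: le_lt_trans; exact: Wmono.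
have [] := sum_prefix N bmono.
set c := (\sum_(j < N) _)%N => cN ck cW.
have hN : 0 <= h * N%:R by rewrite mulr_ge0.
have xcN := grid_nondecreasing lo h0 cN.
have xc0 := grid_nondecreasing lo h0 (leq0n c).
have EN : grid lo h N = lo + h * N%:R by [].
have E0 : grid lo h 0 = lo by rewrite /grid mulr0 addr0.
have Lh : 0 <= L * h by rewrite mulr_ge0.
have FGc := FG (grid lo h c) xs; have GLc := GL (grid lo h c).
have [xcxs|xsxc] := ltP (grid lo h c) xs.
  have {}cN : (c < N)%N.
    rewrite ltn_neqAle cN andbT; apply/eqP => E.
    by move: xcxs; rewrite E; lra.
  have : - eta < G (grid lo h c).
    rewrite ltNge; apply/negP => /(Wlow _ cN) Wc; have := cW cN; by rewrite Wc.
  have : eta * (xs - grid lo h c) <= eta * (h * N%:R) by apply: ler_wpM2l => //; lra.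
  nra.
case: (posnP c) => [c0|].
  rewrite c0 E0 in xsxc *.
  have -> : lo = xs by lra.
  have : 0 <= eta * (h * N%:R) by rewrite mulr_ge0.
  lra.
case Ec : c => [//|k] _; rewrite -?Ec.
have kN : (k < N)%N by rewrite -Ec.
have xk0 := grid_nondecreasing lo h0 (leq0n k).
have xkN := grid_nondecreasing lo h0 (ltnW kN).
have Exc := gridS lo h k; rewrite -Ec in Exc.
have [xkxs|xsxk] := ltP (grid lo h k) xs.
  have : G (grid lo h c) * (grid lo h c - xs) <= L * h.
    apply: (@le_trans _ _ (L * (grid lo h c - xs))).
      by apply: ler_wpM2r => //; lra.
    by apply: ler_wpM2l => //; lra.
  have : 0 <= eta * (h * N%:R) by rewrite mulr_ge0.
  lra.
have Gk : G (grid lo h k) <= eta.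
  rewrite leNgt; apply/negP => /ltW/(Whigh _ kN); rewrite leNgt.
  by rewrite (ck _ Ec).
have := FG (grid lo h k) xs; have := FG (grid lo h c) (grid lo h k).
have : G (grid lo h c) * h <= L * h by apply: ler_wpM2r.
have : G (grid lo h k) * (grid lo h k - xs) <= eta * (h * N%:R).
  apply: (@le_trans _ _ (eta * (grid lo h k - xs))).
    by apply: ler_wpM2r => //; lra.
  by apply: ler_wpM2l => //; lra.
rewrite Exc; nra.
Qed.

End grid.

Section grid_algorithm.
Context {R : realType}.
Variables (T : nat) (a lo h : R).

Definition grid_fun (v : T.-tuple ((R -> R) * (R -> R))) (xi : R) : R :=
  grid lo h (\sum_(j < T) (\prod_(i < T) tilt (a * (tnth v i).2 (grid lo h j)) < 1)%R).

Definition tilted_product (I : instance R) (j : nat) (w : T.-tuple (sample I)) : R :=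
  \prod_(i < T) tilt (a * grad (grid lo h j) (tnth w i)).

Lemma run_grid_fun (I : instance R) w :
  run grid_fun (I := I) w = grid lo h (\sum_(j < T) (tilted_product j w.1 < 1)%R).
Proof.
rewrite /run /grid_fun; congr (grid lo h _).
apply: eq_bigr => j _; congr (nat_of_bool (_ < 1)).
by apply: eq_bigr => i _; rewrite tnth_map.
Qed.

Lemma measurable_tilt_grad (I : instance R) x :
  measurable_fun [set: sample I] (fun s => tilt (a * grad x s)).
Proof.
apply: (measurableT_comp measurable_tilt).
by apply: measurable_funM => //; exact: measurable_grad.
Qed.

Lemma measurable_tilted_product (I : instance R) j :
  measurable_fun [set: T.-tuple (sample I)] (tilted_product (I := I) j).
Proof.
exact: (measurable_tuple_prod (measurable_tilt_grad (I := I) (grid lo h j))).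
Qed.

Lemma measurable_run_grid_fun (I : instance R) :
  measurable_fun [set: T.-tuple (sample I) * measurableTypeR R] (run grid_fun (I := I)).
Proof.
rewrite (_ : run _ (I := I) = fun w => lo + h *
    \sum_(j < T) (if tilted_product (I := I) j w.1 < 1 then 1 else 0)); last first.
  apply/funext => w; rewrite run_grid_fun /grid natr_sum; congr (_ + _ * _).
  by apply: eq_bigr => j _; case: ifP.
apply: measurable_funD => //; apply: measurable_funM => //.
apply: measurable_sum => j; apply: measurable_fun_ifT => //.
apply: measurable_fun_ltr => //.
exact: (measurableT_comp (measurable_tilted_product (I := I) j) measurable_fst).
Qed.

Definition grid_algorithm : algorithm R T :=
  @Algorithm R T grid_fun (fun I _ => @measurable_run_grid_fun I).

End grid_algorithm.

Lemma run_lawX {R : realType} T (I : instance R) (A : set (T.-tuple (sample I)))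
    (B : set (measurableTypeR R)) : measurable A -> measurable B ->
  (run_law T I (A `*` B) = iid (law I) T A * uniform_prob (@ltr01 R) B)%E.
Proof. exact: product_measure1E. Qed.

Section grid_error.
Context {R : realType}.
Variables (I : instance R) (T : nat) (L lo h s : R).
Hypothesis cvxI : convex_instance I.
Hypothesis gradI :
  forall x, (\int[law I]_s (grad x s ^+ 2)%:E <= (L ^+ 2)%:E)%E.
Hypotheses (L0 : 0 < L) (h0 : 0 <= h) (s0 : 0 <= s).

Let a : R := 2 * s / L.
Let q : R := expR (- (4 * s ^+ 2)).

Lemma tilted_product_nondecreasing (w : T.-tuple (sample I)) i j : (i <= j)%N ->
  tilted_product a lo h i w <= tilted_product a lo h j w.
Proof.
move=> ij; apply: ler_prod => k _; rewrite ltW ?tilt_gt0//=.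
apply: tilt_nondecreasing; apply: ler_wpM2l.
  by rewrite divr_ge0 ?mulr_ge0// ltW.
by apply: (grad_nondecreasing cvxI); exact: grid_nondecreasing.
Qed.

Lemma tail_low x : slope I x <= - (4 * L * s) ->
  (iid (law I) T [set w | (1 <= \prod_(i < T) tilt (a * grad x (tnth w i)))%R]
    <= (q ^+ T)%:E)%E.
Proof.
move=> Gx; apply: (@iid_prod_ge1 _ _ _ _ _ (fun z => tilt (a * grad x z))).
- exact: measurable_tilt_grad.
- by move=> z; rewrite ltW ?tilt_gt0.
apply: (le_trans (integral_tilt_le (measurable_grad x) (gradI x) a)).
rewrite lee_fin; apply: le_trans (expR_ge1Dx _).
have aL : a * L = 2 * s by rewrite /a divfK// gt_eqF.
have a0 : 0 <= a by rewrite divr_ge0 ?mulr_ge0// ltW.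
have : a * slope I x <= a * (- (4 * L * s)) by apply: ler_wpM2l.
rewrite -exprMn aL /slope; have -> : a * (- (4 * L * s)) = - (4 * (a * L) * s) by ring.
by rewrite aL; nra.
Qed.

Lemma tail_high x : 4 * L * s <= slope I x ->
  (iid (law I) T [set w | (\prod_(i < T) tilt (a * grad x (tnth w i)) < 1)%R]
    <= (q ^+ T)%:E)%E.
Proof.
move=> Gx.
have mprod b : measurable_fun setT (fun w : T.-tuple (sample I) =>
    \prod_(i < T) tilt (b * grad x (tnth w i))).
  exact: measurable_tuple_prod (measurable_tilt_grad b x).
have mlt := measurable_lt_set (mprod a) 1.
have mge := measurable_ge_set (mprod (- a)) 1.
apply: (@le_trans _ _ (iid (law I) T [set w |
    (1 <= \prod_(i < T) tilt (- a * grad x (tnth w i)))%R])).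
  apply: le_measure; rewrite ?inE// => w /= w1.
  under eq_bigr do rewrite mulNr tiltN.
  by rewrite prodfV invf_ge1 ?ltW// prodr_gt0// => i _; rewrite tilt_gt0.
apply: (@iid_prod_ge1 _ _ _ _ _ (fun z => tilt (- a * grad x z))).
- exact: measurable_tilt_grad.
- by move=> z; rewrite ltW ?tilt_gt0.
apply: (le_trans (integral_tilt_le (measurable_grad x) (gradI x) (- a))).
rewrite lee_fin; apply: le_trans (expR_ge1Dx _).
have aL : a * L = 2 * s by rewrite /a divfK// gt_eqF.
have a0 : 0 <= a by rewrite divr_ge0 ?mulr_ge0// ltW.
have : a * (4 * L * s) <= a * slope I x by apply: ler_wpM2l.
rewrite -exprMn [- a * L]mulNr sqrrN mulNr aL /slope.
have -> : a * (4 * L * s) = 4 * (a * L) * s by ring.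
by rewrite aL; nra.
Qed.

Definition low_event (j : nat) : set (T.-tuple (sample I)) :=
  [set w | 1 <= tilted_product a lo h j w].
Definition high_event (j : nat) : set (T.-tuple (sample I)) :=
  [set w | tilted_product a lo h j w < 1].

Lemma measurable_low_event j : measurable (low_event j).
Proof. exact: measurable_ge_set (measurable_tilted_product _ _ _ _) _. Qed.

Lemma measurable_high_event j : measurable (high_event j).
Proof. exact: measurable_lt_set (measurable_tilted_product _ _ _ _) _. Qed.

(* By monotonicity of the products in the grid index, only the last grid point of
   very negative slope matters: no union bound over the grid. *)
Lemma low_exception : exists B : set (T.-tuple (sample I)),
  [/\ measurable B, (iid (law I) T B <= (q ^+ T)%:E)%E &
    forall w, ~ B w -> forall j, (j < T)%N ->
      slope I (grid lo h j) <= - (4 * L * s) -> tilted_product a lo h j w < 1].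
Proof.
pose p (j : 'I_T) := slope I (grid lo h j) <= - (4 * L * s).
have [[j0 pj0]|noj] := pselect (exists j, p j).
  case: (arg_maxnP (fun j : 'I_T => j : nat) pj0) => j pj jmax.
  exists (low_event j); split; [exact: measurable_low_event|exact: tail_low|].
  move=> w /negP; rewrite -ltNge => wj k kT pk.
  apply: le_lt_trans wj; apply: tilted_product_nondecreasing.
  exact: (jmax (Ordinal kT)).
exists set0; split; rewrite ?measure0 ?lee_fin ?exprn_ge0 ?expR_ge0//.
by move=> w _ j jT pj; case: noj; exists (Ordinal jT).
Qed.

Lemma high_exception : exists B : set (T.-tuple (sample I)),
  [/\ measurable B, (iid (law I) T B <= (q ^+ T)%:E)%E &
    forall w, ~ B w -> forall j, (j < T)%N ->
      4 * L * s <= slope I (grid lo h j) -> 1 <= tilted_product a lo h j w].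
Proof.
pose p (j : 'I_T) := 4 * L * s <= slope I (grid lo h j).
have [[j0 pj0]|noj] := pselect (exists j, p j).
  case: (arg_minnP (fun j : 'I_T => j : nat) pj0) => j pj jmin.
  exists (high_event j); split; [exact: measurable_high_event|exact: tail_high|].
  move=> w /negP; rewrite -leNgt => wj k kT pk.
  apply: (le_trans wj); apply: tilted_product_nondecreasing.
  exact: (jmin (Ordinal kT)).
exists set0; split; rewrite ?measure0 ?lee_fin ?exprn_ge0 ?expR_ge0//.
by move=> w _ j jT pj; case: noj; exists (Ordinal jT).
Qed.

Lemma grid_error (delta xs : R) :
  q ^+ T <= delta / 2 -> lo <= xs <= grid lo h T ->
  (quantile (run_law T I) (1 - delta)
     (fun w => objective I (run (grid_algorithm T a lo h) (I := I) w))
   <= (objective I xs + 4 * L * s * (h * T%:R) + L * h)%:E)%E.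
Proof.
move=> qd xsP.
have [B1 [mB1 PB1 B1P]] := low_exception.
have [B2 [mB2 PB2 B2P]] := high_exception.
have mB : measurable (~` (B1 `|` B2)) by apply: measurableC; exact: measurableU.
apply: (@quantile_le _ _ _ _ _ _ _ (~` (B1 `|` B2) `*` setT)).
- exact: measurableX.
- rewrite -[X in measurable X]setTI.
  have mr := @measurable_run_grid_fun R T a lo h I.
  exact: (mr measurableT _ (measurable_objective_sublevel cvxI gradI
    (objective I xs + 4 * L * s * (h * T%:R) + L * h))).
- move=> [w xi] [/= /not_orP[nB1 nB2] _].
  rewrite run_grid_fun; apply: (@grid_crossing _ _ (slope I) _ _ _ L _ _
    (fun j => tilted_product a lo h j w)) => //.
  + exact: (objective_subgradient cvxI gradI).
  + exact: (slope_le gradI L0).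
  + by rewrite !mulr_ge0// ltW.
  + exact: ltW.
  + by move=> i j; exact: tilted_product_nondecreasing.
  + exact: B1P.
  + exact: B2P.
- rewrite run_lawX// probability_setT mule1 probability_setC; last exact: measurableU.
  rewrite EFinB leeB//; apply: (le_trans (measureU2 _ _ _)) => //.
  rewrite (_ : delta = delta / 2 + delta / 2); last by field.
  by rewrite EFinD leeD// (le_trans PB1, le_trans PB2)// lee_fin.
Qed.
End grid_error.

Section minimax.
Context {R : realType}.
Implicit Types (I : instance R) (C : instance_class R).

Lemma ereal_inf_objective I xs : minimizers I xs ->
  ereal_inf [set (objective I x)%:E | x in [set: R]] = (objective I xs)%:E.
Proof.
move=> mxs; apply/eqP; rewrite eq_le; apply/andP; split.
  by apply: ereal_inf_lbound; exists xs.
by apply/ereal_infP => _ [x _ <-]; rewrite lee_fin; exact: mxs.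
Qed.

Lemma ErrE T (delta : R) (alg : algorithm R T) I xs : minimizers I xs ->
  Err delta alg I = (quantile (run_law T I) (1 - delta)
     (fun w => objective I (run alg w)) - (objective I xs)%:E)%E.
Proof. by move=> mxs; rewrite /Err (ereal_inf_objective mxs). Qed.

Lemma Err_ge0 T (delta : R) (alg : algorithm R T) I xs :
  delta < 1 -> minimizers I xs -> (0 <= Err delta alg I)%E.
Proof.
move=> d1 mxs; rewrite (ErrE _ _ mxs) sube_ge0//.
apply/ereal_infP => _ [y /= hy <-]; rewrite lee_fin leNgt; apply/negP => yxs.
move: hy; rewrite (_ : [set w | _] = set0) ?measure0 ?lee_fin; first by lra.
by rewrite -subset0 => w /= Yw; have := le_lt_trans Yw yxs; rewrite ltNge mxs.
Qed.

Lemma PoA_ge T (delta K U : R) (alg : algorithm R T) (M : instance_class R -> Prop)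
    C I xs :
  delta < 1 -> 0 <= K -> 0 < U -> M C -> C I -> minimizers I xs ->
  (Err_minimax T delta C <= U%:E)%E -> ((K * U)%:E <= Err delta alg I)%E ->
  (K%:E <= PoA delta alg M)%E.
Proof.
move=> d1 K0 U0 MC CI mxs mU KU.
have m0 : (0 <= Err_minimax T delta C)%E.
  apply/ereal_infP => _ [alg' ->]; apply: le_ereal_sup_tmp.
  by exists (Err delta alg' I); [exists I | exact: Err_ge0 mxs].
apply: le_ereal_sup_tmp.
exists (Err_class delta alg C / Err_minimax T delta C)%E; first by exists C.
rewrite (_ : K%:E = (K * U)%:E * (U%:E)^-1)%E; last first.
  by rewrite inver gt_eqF// -EFinM mulfK// gt_eqF.
apply: lee_pmul => //.
- by rewrite lee_fin mulr_ge0// ltW.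
- by rewrite inve_ge0 lee_fin ltW.
- by apply: (le_trans KU); apply: ereal_sup_ubound; exists I.
- by rewrite lee_pV2// inE lee_fin ltW.
Qed.

Definition rate (T : nat) (delta : R) : R := Num.sqrt (ln (1 / delta) / T%:R).

Section rate.
Variables (T : nat) (delta : R).
Hypotheses (T0 : (0 < T)%N) (delta01 : 0 < delta < 3^-1).

Let L := ln (1 / delta).

Lemma expRN_ln : expR (- L) = delta.
Proof.
have /andP[d0 _] := delta01.
by rewrite /L div1r lnV ?posrE// opprK lnK ?posrE.
Qed.

Lemma ln_ge_half : 2^-1 <= L.
Proof.
have /andP[d0 d1] := delta01.
by have := expR_ge1Dx (- L); rewrite expRN_ln; lra.
Qed.

Lemma rate_sqr : rate T delta ^+ 2 = L / T%:R.
Proof. by rewrite sqr_sqrtr// divr_ge0// (le_trans _ ln_ge_half). Qed.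

Lemma rate_gt0 : 0 < rate T delta.
Proof. by rewrite sqrtr_gt0 divr_gt0 ?ltr0n// (lt_le_trans _ ln_ge_half). Qed.

Lemma invn_le_rate : T%:R^-1 <= 2 * rate T delta.
Proof.
rewrite -(@ler_pXn2r _ 2)// ?nnegrE ?mulr_ge0 ?(ltW rate_gt0)//.
rewrite exprMn rate_sqr.
have T1 : (1 : R) <= T%:R by rewrite ler1n.
have V1 : T%:R^-1 <= 1 :> R by rewrite invf_le1// ltr0n.
have V0 : 0 < T%:R^-1 :> R by rewrite invr_gt0 ltr0n.
have := ln_ge_half; nra.
Qed.

Lemma expR_rate : expR (- (4 * rate T delta ^+ 2)) ^+ T <= delta / 2.
Proof.
have /andP[d0 d1] := delta01.
have -> : expR (- (4 * rate T delta ^+ 2)) ^+ T = delta ^+ 4.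
  transitivity (expR (- L) ^+ 4); last by rewrite expRN_ln.
  rewrite -expRM_natl -(expRM_natl 4) rate_sqr; congr expR.
  by field; rewrite pnatr_eq0 -lt0n.
have d2 : delta ^+ 2 <= 3^-1 * delta by nra.
have d2_ge0 := sqr_ge0 delta.
rewrite (exprM delta 2 2); nra.
Qed.

End rate.

Lemma class_SMLip_sqr (L r : R) I x : class_SMLip L r I ->
  (\int[law I]_s (grad x s ^+ 2)%:E <= (L ^+ 2)%:E)%E.
Proof.
move=> [_ /(_ x)]; rewrite unlock => + _; apply: le_trans.
rewrite le_eqVlt; apply/predU1P; left.
by apply: eq_integral => s _; rewrite real_normK// num_real.
Qed.

Lemma minimizer_of_set_norm I (r : R) : 0 < r -> (set_norm (minimizers I) <= r%:E)%E ->
  exists2 xs, minimizers I xs & `|xs| <= 2 * r.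
Proof.
move=> r0 hr.
have : (set_norm (minimizers I) < (2 * r)%:E)%E.
  by apply: (le_lt_trans hr); rewrite lte_fin; lra.
by move=> /ereal_inf_lt[_ [x mx <-]]; rewrite lte_fin => /ltW xr; exists x.
Qed.

Lemma Err_minimax_SMLip T (delta L r : R) :
  (0 < T)%N -> 0 < delta < 3^-1 -> 0 < L -> 0 < r ->
  (Err_minimax T delta (class_SMLip L r) <= (24 * L * r * rate T delta)%:E)%E.
Proof.
move=> T0 d01 L0 r0.
have TR : (0 : R) < T%:R by rewrite ltr0n.
pose s := rate T delta; have s0 : 0 < s := rate_gt0 T0 d01.
pose h := 4 * r / T%:R.
have hT : h * T%:R = 4 * r by rewrite /h divfK// gt_eqF.
have h0 : 0 <= h by rewrite divr_ge0 ?mulr_ge0// ltW.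
apply: ge_ereal_inf.
exists (Err_class delta (grid_algorithm T (2 * s / L) (- (2 * r)) h) (class_SMLip L r)).
  by eexists.
apply: ge_ereal_sup => _ [I CI ->].
have [cvxI _ nI] := CI.
have [xs mxs xsr] := minimizer_of_set_norm r0 nI.
rewrite (ErrE _ _ mxs) leeBlDr//.
have xsg : - (2 * r) <= xs <= grid (- (2 * r)) h T.
  by move: xsr; rewrite /grid hT ler_norml => /andP[? ?]; apply/andP; split; lra.
apply: (le_trans (grid_error cvxI (fun x => class_SMLip_sqr x CI) L0 h0 (ltW s0)
  (expR_rate T0 d01) xsg)).
rewrite -EFinD lee_fin hT.
have : L * h <= L * (4 * r * (2 * s)).
  apply: ler_wpM2l; first exact: ltW.
  by apply: ler_wpM2l; [rewrite mulr_ge0// ltW | exact: invn_le_rate].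
rewrite -/s; nra.
Qed.

Lemma lipschitz_subgradient_le (f : R -> R) (L x v : R) :
  L.-lipschitz (f : R -> R) -> subdifferential f x v -> `|v| <= L.
Proof.
move=> Lf fv.
have := fv (x + 1); have := Lf (x + 1, x) (conj Logic.I Logic.I).
have := fv (x - 1); have := Lf (x - 1, x) (conj Logic.I Logic.I).
rewrite /= ![x + _ - x]addrAC !subrr !add0r normrN normr1 !mulr1 mulrN1.
move=> /(le_trans (ler_norm _)) h1 h2 /(le_trans (ler_norm _)) h3 h4.
by rewrite ler_norml; apply/andP; split; lra.
Qed.

Lemma class_Lip_SMLip (L r : R) I : class_Lip L r I -> class_SMLip L r I.
Proof.
move=> [cvxI LI nI]; split=> // x; rewrite unlock.
apply: (@le_trans _ _ (\int[law I]_s (L ^+ 2)%:E)%E).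
  apply: ge0_le_integral => //.
  - apply/measurable_EFinP; apply: measurable_funX.
    by apply: (measurableT_comp (@normr_measurable _ _)); exact: measurable_grad.
  - move=> s _; rewrite lee_fin ler_sqr ?nnegrE//.
      exact: lipschitz_subgradient_le (LI s) (grad_subdifferential (cvxI s) x).
    apply: le_trans (lipschitz_subgradient_le (LI s) (grad_subdifferential (cvxI s) x)).
    exact: normr_ge0.
have PT : law I setT = 1%E := probability_setT _.
by rewrite integral_cst// -[leRHS]mule1 -PT.
Qed.

Lemma Err_minimax_subclass T (delta : R) C1 C2 : (forall I, C1 I -> C2 I) ->
  (Err_minimax T delta C1 <= Err_minimax T delta C2)%E.
Proof.
move=> C12; apply/ereal_infP => _ [alg ->].
apply: ge_ereal_inf; exists (Err_class delta alg C1); first by exists alg.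
apply: ge_ereal_sup => _ [I CI ->]; apply: ereal_sup_ubound.
by exists I => //; exact: C12.
Qed.

End minimax.

Section two_point_instance.
Context {R : realType}.
Variables (p : R) (amp ctr : bool -> R).
Hypotheses (p01 : 0 <= p <= 1) (amp0 : forall b, 0 <= amp b).

Let absloss (x : R) (b : bool) : R := amp b * `|x - ctr b|.
Let absgrad (x : R) (b : bool) : R := amp b * Num.sg (x - ctr b).

Let absloss_ge0 x b : 0 <= absloss x b.
Proof. by rewrite mulr_ge0. Qed.

Let absloss_integrable x :
  (bernoulli_prob p : probability bool R).-integrable [set: bool]
    (fun b => (absloss x b)%:E).
Proof.
apply/integrableP; split => //.
under eq_integral do rewrite gee0_abs ?lee_fin//.
rewrite integral_bernoulli_prob//; last by move=> b; rewrite lee_fin.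
exact: (ltry (p * absloss x true + (1 - p) * absloss x false)).
Qed.

Lemma sgr_nondecreasing : {homo (@Num.sg R) : x y / x <= y}.
Proof. by move=> x y xy; case: (sgrP x) => ?; case: (sgrP y) => ?; lra. Qed.

Let absgrad_measurable :
  measurable_fun [set: R * bool] (fun z => absgrad z.1 z.2).
Proof.
apply: measurable_funM.
  by apply: (@measurableT_comp _ _ _ _ _ _ amp).
apply: (@measurableT_comp _ _ _ _ _ _ (@Num.sg R)).
  by apply: nondecreasing_measurable => //; exact: sgr_nondecreasing.
apply: measurable_funB => //.
by apply: (@measurableT_comp _ _ _ _ _ _ ctr).
Qed.

Let absgrad_subdifferential b x : subdifferential (absloss ^~ b) x (absgrad x b).
Proof.
move=> y; rewrite /absloss /absgrad -mulrA -mulrDr ler_wpM2l//.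
rewrite [X in X + _]normrEsg -mulrDr [X in _ * X](_ : _ = y - ctr b); last by ring.
apply: (le_trans (ler_norm _)); rewrite normrM normr_sg ler_piMl//.
by case: eqP.
Qed.

Definition two_point : instance R :=
  @Instance R _ bool (bernoulli_prob p) absloss absgrad
    absloss_integrable absgrad_measurable
    (fun b _ x => @absgrad_subdifferential b x).

Lemma two_point_convex : convex_instance two_point.
Proof.
move=> b t x y _ _; rewrite /loss /= /absloss.
have t0 : 0 <= t%:num :> R by [].
have t1 : t%:num <= 1 :> R by [].
change (amp b * `|t%:num * (x : R) + (1 - t%:num) * (y : R) - ctr b| <=
  t%:num * (amp b * `|x - ctr b|) + (1 - t%:num) * (amp b * `|y - ctr b|)).
move: (t%:num : R) t0 t1 => u u0 u1.
rewrite (_ : u * x + (1 - u) * y - ctr b =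
  u * (x - ctr b) + (1 - u) * (y - ctr b)); last by ring.
rewrite mulrCA [(1 - u) * (amp b * _)]mulrCA -mulrDr ler_wpM2l//.
apply: (le_trans (ler_normD _ _)).
by rewrite !normrM (ger0_norm u0) (@ger0_norm _ (1 - u)) ?subr_ge0.
Qed.

Lemma two_point_lipschitz (L : R) : (forall b, amp b <= L) ->
  forall b, L.-lipschitz (absloss ^~ b : R -> R).
Proof.
move=> ampL b [x y] _ /=.
rewrite /absloss -mulrBr normrM (ger0_norm (amp0 b)).
apply: ler_pM => //.
by apply: (le_trans (ler_dist_dist _ _)); rewrite opprB addrA subrK.
Qed.

Lemma objective_two_point x : objective two_point x =
  p * (amp true * `|x - ctr true|) + (1 - p) * (amp false * `|x - ctr false|).
Proof.
by rewrite /objective unlock /= integral_bernoulli_prob// => b; rewrite lee_fin.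
Qed.

Lemma two_point_Lip (L r m : R) : (forall b, amp b <= L) ->
  minimizers two_point m -> `|m| <= r -> class_Lip L r two_point.
Proof.
move=> ampL mm mr; split.
- exact: two_point_convex.
- exact: two_point_lipschitz.
- by apply: ge_ereal_inf; exists `|m|%:E => //; exists m.
Qed.

Lemma two_point_SMLip (L r m : R) :
  p * amp true ^+ 2 + (1 - p) * amp false ^+ 2 <= L ^+ 2 ->
  minimizers two_point m -> `|m| <= r -> class_SMLip L r two_point.
Proof.
move=> ampL mm mr; split.
- exact: two_point_convex.
- move=> x; rewrite unlock /= integral_bernoulli_prob//.
  rewrite /grad /= /absgrad.
  have sg1 b : `|amp b * Num.sg (x - ctr b)| ^+ 2 <= amp b ^+ 2.
    rewrite ler_sqr ?nnegrE// normrM ger0_norm// ler_piMr// normr_sg.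
    by case: eqP.
  change ((p * `|amp true * Num.sg (x - ctr true)| ^+ 2 +
    (1 - p) * `|amp false * Num.sg (x - ctr false)| ^+ 2)%:E <= (L ^+ 2)%:E)%E.
  rewrite lee_fin; apply: le_trans ampL.
  have /andP[p0 p1] := p01.
  by apply: lerD; apply: ler_wpM2l => //; rewrite subr_ge0.
- by apply: ge_ereal_inf; exists `|m|%:E => //; exists m.
Qed.

End two_point_instance.

Section indistinguishable.
Context {R : realType}.
Variables (T : nat) (p eps rho delta : R) (alg : algorithm R T).
Hypotheses (p0 : 0 < p) (p2 : p <= 2^-1) (eps0 : 0 < eps) (rho0 : 0 < rho).

Let p01 : 0 <= p <= 1.
Proof. by move: p0 p2 => *; apply/andP; split; lra. Qed.

(* Rare samples (true) have slope 2 eps / p, so that their mean contribution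
   2 eps |x| outweighs the common samples and moves the minimizer to 0. *)
Definition rare_amp (b : bool) : R := if b then 2 * eps / p else eps.
Definition rare_ctr (b : bool) : R := if b then 0 else rho.

Let rare_amp_ge0 b : 0 <= rare_amp b.
Proof. by case: b; rewrite /rare_amp ?divr_ge0 ?mulr_ge0// ltW. Qed.

Let plain_amp_ge0 (b : bool) : 0 <= eps.
Proof. exact: ltW. Qed.

Definition rare : instance R := two_point rare_ctr p01 rare_amp_ge0.
Definition plain : instance R := two_point (fun=> rho) p01 plain_amp_ge0.

Lemma objective_plain x : objective plain x = eps * `|x - rho|.
Proof. by rewrite objective_two_point; ring. Qed.

Lemma objective_rare x :
  objective rare x = 2 * eps * `|x| + (1 - p) * eps * `|x - rho|.
Proof.
rewrite objective_two_point /rare_amp /rare_ctr subr0.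
by field; rewrite gt_eqF.
Qed.

Lemma minimizers_plain : minimizers plain rho.
Proof.
by move=> y; rewrite !objective_plain subrr normr0 mulr0 mulr_ge0// ltW.
Qed.

Lemma objective_rare_ge x : eps * `|x| <= objective rare x - objective rare 0.
Proof.
rewrite !objective_rare normr0 sub0r normrN (gtr0_norm rho0).
have h : rho - `|x| <= `|x - rho|.
  have := ler_normD (x - rho) (- x).
  by rewrite addrAC subrr add0r !normrN (gtr0_norm rho0); lra.
have : (1 - p) * eps * (rho - `|x|) <= (1 - p) * eps * `|x - rho|.
  apply: ler_wpM2l => //; apply: mulr_ge0; last exact: ltW.
  by rewrite subr_ge0; case/andP: p01.
have : 0 <= p * (eps * `|x|) by rewrite !mulr_ge0// ltW.
lra.
Qed.

Lemma minimizers_rare : minimizers rare 0.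
Proof.
move=> y; have := objective_rare_ge y.
have : 0 <= eps * `|y| by rewrite mulr_ge0// ltW.
lra.
Qed.

Definition plain_output (xi : R) : R :=
  alg (nseq_tuple T (@sample_data R plain false)) xi.

Lemma run_plain w : run alg (I := plain) w = plain_output w.2.
Proof.
rewrite /run /plain_output; congr (alg _ _).
by apply: eq_from_tnth => i; rewrite tnth_map tnth_nseq.
Qed.

Lemma run_rare w : (forall i, tnth w.1 i = false) ->
  run alg (I := rare) w = plain_output w.2.
Proof.
move=> hw; rewrite /run /plain_output; congr (alg _ _).
by apply: eq_from_tnth => i; rewrite tnth_map tnth_nseq hw.
Qed.

Lemma measurable_plain_output : measurable_fun [set: measurableTypeR R] plain_output.
Proof.
have mr := @alg_measurable R T alg plain (@two_point_convex _ _ _ _ _ _).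
have := measurableT_comp mr (@pair1_measurable _ _ _ (measurableTypeR R)
  (nseq_tuple T false)).
rewrite (_ : _ \o _ = plain_output)//.
by apply/funext => xi /=; rewrite run_plain.
Qed.

Lemma Err_plain_or_rare : delta < (1 - p) ^+ T * (1 - delta) ->
  ((eps * rho / 2)%:E <= Err delta alg plain)%E \/
  ((eps * rho / 2)%:E <= Err delta alg rare)%E.
Proof.
move=> hidden.
case: (leP (eps * rho / 2)%:E (Err delta alg plain)) => [|Eplain]; [by left|right].
pose E := [set xi : measurableTypeR R | rho / 2 <= plain_output xi].
have mE : measurable E := measurable_ge_set measurable_plain_output _.
have PE : ((1 - delta)%:E <= uniform_prob (@ltr01 R) E)%E.
  move: Eplain; rewrite (ErrE _ _ minimizers_plain) objective_plain subrr normr0 mulr0.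
  rewrite sube0 => /quantile_lt[y yv hy]; apply: (le_trans hy).
  rewrite (_ : [set w | _] = setT `*` [set xi : measurableTypeR R |
      eps * `|plain_output xi - rho| <= y]); last first.
    apply/seteqP; split => w /=; rewrite run_plain objective_plain//.
    by move=> [].
  have mY : measurable [set xi : measurableTypeR R |
      eps * `|plain_output xi - rho| <= y].
    apply: (measurable_le_set (f := fun xi => eps * `|plain_output xi - rho|)).
    apply: measurable_funM => //.
    apply: (measurableT_comp (@normr_measurable _ _)).
    by apply: measurable_funB => //; exact: measurable_plain_output.
  rewrite run_lawX// probability_setT mul1e le_measure ?inE//.
  move=> xi /= h; have : eps * `|plain_output xi - rho| < eps * (rho / 2) by lra.
  by rewrite ltr_pM2l// ltr_norml /E /= => /andP[]; lra.
rewrite (ErrE _ _ minimizers_rare) leeBrDr// -EFinD.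
have mf : measurable [set false] by [].
have mrun := @alg_measurable R T alg rare (@two_point_convex _ _ _ _ _ _).
apply: (@quantile_ge _ _ _ _ _ _ _
  ([set w : T.-tuple (sample rare) | forall i, [set false] (tnth w i)] `*` E)).
- by apply: measurableX => //; exact: measurable_tuple_box.
- move=> y; under eq_set do rewrite objective_rare.
  apply: (measurable_le_set (f := fun w => 2 * eps * `|run alg (I := rare) w|
    + (1 - p) * eps * `|run alg (I := rare) w - rho|)).
  apply: measurable_funD; apply: measurable_funM => //.
    exact: (measurableT_comp (@normr_measurable _ _)).
  apply: (measurableT_comp (@normr_measurable _ _)).
  exact: measurable_funB.
- move=> w [/= hw Ew]; rewrite (run_rare hw).
  have := objective_rare_ge (plain_output w.2).
  have : eps * (rho / 2) <= eps * `|plain_output w.2|.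
    by rewrite ler_pM2l// (le_trans Ew)// ler_norm.
  lra.
- rewrite run_lawX//; last exact: measurable_tuple_box.
  rewrite opprB addrC subrK iid_box//=.
  rewrite bernoulli_probE// !diracE memNset//= mem_set// mule0 add0e mule1.
  apply: (@lt_le_trans _ _ (((1 - p) ^+ T)%:E * (1 - delta)%:E)%E).
    by rewrite -EFinM lte_fin.
  rewrite EFin_expe; apply: lee_wpmul2l => //; apply: expe_ge0.
  by rewrite lee_fin subr_ge0; case/andP: p01.
Qed.

End indistinguishable.

Section lower_bound.
Context {R : realType}.

Lemma expR_le_onem (p : R) : 0 <= p -> p <= 2^-1 -> expR (- (2 * p)) <= 1 - p.
Proof.
move=> p0 p2; rewrite expRN -[leLHS]mul1r ler_pdivrMr ?expR_gt0//.
have : (1 - p) * (1 + 2 * p) <= (1 - p) * expR (2 * p).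
  by apply: ler_wpM2l; [lra | exact: expR_ge1Dx].
nra.
Qed.

Lemma hidden_prob (T : nat) (delta p : R) : (0 < T)%N -> 0 < delta < 3^-1 ->
  0 < p -> p <= 2^-1 -> p <= rate T delta ^+ 2 / 4 ->
  delta < (1 - p) ^+ T * (1 - delta).
Proof.
move=> T0 d01 p0 p2 pr; have /andP[d0 d1] := d01.
set r := expR (- (ln (1 / delta) / 2)).
have r0 : 0 < r := expR_gt0 _.
have rr : r ^+ 2 = delta.
  rewrite /r -expRM_natl -[RHS](expRN_ln d01); congr expR.
  by field.
have rT : r <= (1 - p) ^+ T.
  apply: (@le_trans _ _ (expR (- (2 * p)) ^+ T)).
    rewrite -expRM_natl ler_expR mulrN lerN2.
    have : T%:R * p <= T%:R * (rate T delta ^+ 2 / 4) by apply: ler_wpM2l.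
    rewrite (rate_sqr T d01) (_ : T%:R * (_ / _ / 4) = ln (1 / delta) / 4); last first.
      by field; rewrite pnatr_eq0 -lt0n.
    lra.
  apply: lerXn2r; rewrite ?nnegrE ?expR_ge0//; first by lra.
  by apply: expR_le_onem => //; exact: ltW.
apply: (@lt_le_trans _ _ (r * (1 - delta))).
  have r23 : r < 2 / 3 by rewrite ltNge; apply/negP => ?; nra.
  rewrite -[X in X < _]rr; nra.
by apply: ler_wpM2r => //; lra.
Qed.

Lemma plain_Lip (p eps rho : R) (p0 : 0 < p) (p2 : p <= 2^-1) (eps0 : 0 < eps) :
  0 < rho -> eps <= 1 -> class_Lip 1 rho (plain rho p0 p2 eps0).
Proof.
move=> rho0 eps1.
apply: (two_point_Lip (m := rho)) => //; first exact: minimizers_plain.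
by rewrite gtr0_norm.
Qed.

(* The amplitude eps = 48 K s makes the error eps rho / 2 equal to K times the
   minimax bound 24 rho s of the class with parameters (1, rho). *)
Lemma PoA_family (Cl : R -> R -> instance_class R) (M : instance_class R -> Prop)
    (T : nat) (delta K L rho : R) (alg : algorithm R T) :
  let s := rate T delta in
  let p := Num.min 2^-1 (s ^+ 2 / 4) in
  (0 < T)%N -> 0 < delta < 3^-1 -> 0 < K -> 1 <= L -> L <= rho ->
  M (Cl 1 rho) -> M (Cl L 1) ->
  (forall L' r I, Cl L' r I -> class_SMLip L' r I) ->
  (forall p0 p2 eps0, Cl 1 rho (@plain R p (48 * K * s) rho p0 p2 eps0)) ->
  (forall p0 p2 eps0, Cl L 1 (@rare R p (48 * K * s) rho p0 p2 eps0)) ->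
  (K%:E <= PoA delta alg M)%E.
Proof.
move=> s p T0 d01 K0 L1 Lrho M1 ML ClSM Clplain Clrare.
have /andP[d0 d1] := d01.
have s0 : 0 < s := rate_gt0 T0 d01.
have p0 : 0 < p by rewrite /p lt_min invr_gt0 ltr0n divr_gt0// exprn_gt0.
have p2 : p <= 2^-1 by rewrite /p ge_min lexx.
have ps : p <= s ^+ 2 / 4 by rewrite /p ge_min lexx orbT.
have eps0 : 0 < 48 * K * s by rewrite !mulr_gt0.
have rho0 : 0 < rho by lra.
have minimax L' r : 0 < L' -> 0 < r ->
    (Err_minimax T delta (Cl L' r) <= (24 * L' * r * s)%:E)%E.
  move=> L'0 r0; apply: le_trans (Err_minimax_SMLip T0 d01 L'0 r0).
  by apply: Err_minimax_subclass => I; exact: ClSM.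
have U0 L' r : 0 < L' -> 0 < r -> 0 < 24 * L' * r * s.
  by move=> L'0 r0; rewrite !mulr_gt0.
have d_lt1 : delta < 1 by lra.
have hid := hidden_prob T0 d01 p0 p2 ps.
have [h|h] := Err_plain_or_rare alg p0 p2 eps0 rho0 hid.
- apply: (PoA_ge d_lt1 (ltW K0) (U0 1 rho ltr01 rho0) M1 (Clplain p0 p2 eps0)
    (minimizers_plain rho p0 p2 eps0) (minimax 1 rho ltr01 rho0)).
  by apply: le_trans h; rewrite lee_fin; lra.
- have L0 : 0 < L by lra.
  apply: (PoA_ge d_lt1 (ltW K0) (U0 L 1 L0 ltr01) ML (Clrare p0 p2 eps0)
    (minimizers_rare p0 p2 eps0 rho0) (minimax L 1 L0 ltr01)).
  apply: le_trans h; rewrite lee_fin.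
  have : K * s * L <= K * s * rho by rewrite ler_wpM2l// ltW// mulr_gt0.
  lra.
Qed.

End lower_bound.

Theorem theorem3 (R : realType) :
  exists2 c : R, 0 < c &
    forall (T : nat) (l rho delta : R) (alg : algorithm R T),
      (0 < T)%N -> 1 <= l -> 1 <= rho -> 0 < delta < 3^-1 ->
      ((c * Num.min
              (Num.min l rho * Num.sqrt (ln (1 / delta)) / Num.sqrt T%:R)
              (Num.sqrt (T%:R / ln (1 / delta))))%:E
        <= PoA delta alg (family_Lip l rho))%E
      /\
      ((c * Num.min rho
              (Num.min l (Num.sqrt (T%:R / ln (1 / delta)))))%:E
        <= PoA delta alg (family_SMLip l rho))%E.
Proof.
have [c c0 c384] : exists2 c : R, 0 < c & 384 * c = 1.
  by exists (384^-1); rewrite ?invr_gt0 ?ltr0n ?mulfV ?pnatr_eq0.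
exists c => // T l rho delta alg T0 l1 rho1 d01.
have TR : (0 : R) < T%:R by rewrite ltr0n.
have Lam := ln_ge_half d01.
set s := rate T delta; have s0 : 0 < s := rate_gt0 T0 d01.
have -> : Num.sqrt (T%:R / ln (1 / delta)) = s^-1.
  by rewrite /s /rate -sqrtrV ?invf_div// divr_ge0//; lra.
rewrite -mulrA; have -> : Num.sqrt (ln (1 / delta)) / Num.sqrt T%:R = s.
  by rewrite /s /rate sqrtrM ?sqrtrV//; lra.
set L := Num.min l rho.
have L1 : 1 <= L by rewrite le_min l1.
have Ll : L <= l by rewrite ge_min lexx.
have Lrho : L <= rho by rewrite ge_min lexx orbT.
have sV0 : 0 < s^-1 by rewrite invr_gt0.
have sVs : s^-1 * s = 1 by rewrite mulVf// gt_eqF.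
set p := Num.min 2^-1 (s ^+ 2 / 4).
have pP x : x <= 2^-1 -> x <= s ^+ 2 / 4 -> x <= p by rewrite le_min => -> ->.
split.
- set K := _ * Num.min _ _.
  have K0 : 0 < K by rewrite mulr_gt0// lt_min sV0 andbT mulr_gt0//; lra.
  have KL : 384 * K <= L * s by rewrite /K mulrA c384 mul1r ge_min lexx.
  have Ks : 384 * K <= s^-1 by rewrite /K mulrA c384 mul1r ge_min lexx orbT.
  have Ks1 : 384 * (K * s) <= 1 by rewrite -[leRHS]sVs mulrA ler_wpM2r// ltW.
  apply: (@PoA_family _ (@class_Lip R) _ _ _ _ L rho) => //.
  + by exists 1, rho; split; rewrite ?lexx ?l1 ?rho1.
  + by exists L, 1; split; rewrite ?lexx ?L1 ?Ll ?rho1.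
  + by move=> L' r I; exact: class_Lip_SMLip.
  + by move=> p0 p2 eps0; apply: plain_Lip; [lra|rewrite -/s; lra].
  + move=> p0 p2 eps0; rewrite -/s -/p in p0 p2 eps0 *.
    apply: (two_point_Lip (m := 0)); last by rewrite normr0.
      case; rewrite /rare_amp; last by lra.
      rewrite ler_pdivrMr//.
      have : 96 * (K * s) / L <= p.
        apply: pP; rewrite ler_pdivrMr//; try lra.
        have : 384 * (K * s) <= L * s * s by rewrite mulrA ler_wpM2r// ltW.
        lra.
      rewrite ler_pdivrMr; lra.
    by apply: minimizers_rare => //; lra.
- set K := _ * Num.min _ _.
  have K0 : 0 < K by rewrite mulr_gt0// !lt_min sV0 andbT; lra.
  have KL : 384 * K <= L.
    by rewrite /K mulrA c384 mul1r le_min !ge_min !lexx !orbT.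
  have Ks : 384 * K <= s^-1 by rewrite /K mulrA c384 mul1r !ge_min !lexx !orbT.
  have Ks1 : 384 * (K * s) <= 1 by rewrite -[leRHS]sVs mulrA ler_wpM2r// ltW.
  apply: (@PoA_family _ (@class_SMLip R) _ _ _ _ L rho) => //.
  + by exists 1, rho; split; rewrite ?lexx ?l1 ?rho1.
  + by exists L, 1; split; rewrite ?lexx ?L1 ?Ll ?rho1.
  + by move=> p0 p2 eps0; apply/class_Lip_SMLip/plain_Lip; [lra|rewrite -/s; lra].
  + move=> p0 p2 eps0; rewrite -/s -/p in p0 p2 eps0 *.
    apply: (two_point_SMLip (m := 0)); last by rewrite normr0.
      rewrite /rare_amp; set e := 48 * K * s.
      have L2 : 1 <= L ^+ 2 by nra.
      have q2 : (384 * (K * s)) ^+ 2 <= 1.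
        have : 0 < K * s by rewrite mulr_gt0.
        nra.
      have K2 : (384 * K) ^+ 2 <= L ^+ 2 by nra.
      have K2s : (384 * K) ^+ 2 * s ^+ 2 <= L ^+ 2 * s ^+ 2.
        by apply: ler_wpM2r => //; exact: sqr_ge0.
      have e2 : 5 * e ^+ 2 <= p * L ^+ 2.
        rewrite -ler_pdivrMr; last by lra.
        by apply: pP; rewrite ler_pdivrMr ?/e; nra.
      have p1 : p <= 1 by lra.
      have pe : 0 <= p * e ^+ 2 by rewrite mulr_ge0 ?sqr_ge0// ltW.
      have -> : p * (2 * e / p) ^+ 2 = 4 * e ^+ 2 / p by field; rewrite gt_eqF.
      have : 4 * e ^+ 2 / p <= 4 / 5 * L ^+ 2 by rewrite ler_pdivrMr//; lra.
      have : p * L ^+ 2 <= L ^+ 2 by nra.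
      nra.
    by apply: minimizers_rare => //; lra.
Qed.
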